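(* Let $\{\Xi,\Omega,\mathcal M,\Lambda\}$ be a computational problem with $\mathcal M=\mathbb R^d$ and let $\kappa\ge 0$. Let $\Xi^*:\Omega\to\{0,1\}$ be a function (a candidate `I don't know' function) and put $\Omega_1^*=(\Xi^* )^{-1}(1)$. 1. There exists a $\kappa$-trustworthy AI $\Gamma:\Omega\to\mathcal M\cup\{\mathrm{idk}\}$ whose associated `I don't know' function equals $\Xi^*$ if and only if both of the following hold: (a) $\{\Xi^*,\Omega,\{0,1\},\Lambda\}\in\Delta_0^A$; (b) there exists an algorithm $\Gamma^*:\Omega_1^*\to\mathcal M$ with $\Gamma^*(\iota)\in B_\kappa(\Xi(\iota))$ for every $\iota$ with $\Xi^*(\iota)=1$. 2. There exists a $\kappa$-trustworthy AI with `giving up' parameter $\{\Gamma_n\}_{n\in\mathbb N}$, $\Gamma_n:\Omega\to\mathcal M\cup\{\mathrm{idk}\}$, whose associated `I don't know' function equals $\Xi^*$ if and only if both of the following hold: (a) $\{\Xi^*,\Omega,\{0,1\},\Lambda\}\in\Sigma_1^A$; (b) there exists an algorithm $\Gamma^*:\Omega_1^*\to\mathcal M$ with $\Gamma^*(\iota)\in B_\kappa(\Xi(\iota))$ for every $\iota$ with $\Xi^*(\iota)=1$.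
   Context: Computational problem: $\Omega$ is a set of inputs; $\Lambda=\{f_1,\dots,f_k\}$ is a finite set of functions $f_i:\Omega\to\mathbb Q$ such that $\iota_1=\iota_2$ iff $f_i(\iota_1)=f_i(\iota_2)$ for all $i$; $(\mathcal M,d_{\mathcal M})$ is a metric space; $\Xi:\Omega\rightrightarrows\mathcal M$ is a possibly multi-valued map. $B_r(S)=\bigcup_{x\in S}\{z\in\mathcal M:d_{\mathcal M}(z,x)\le r\}$. An algorithm (AI) $\Gamma$ on $\Omega$ is a map computed by a Turing machine that receives $(f_1(\iota),\dots,f_k(\iota))\in\mathbb Q^k$ and outputs an element of $\mathbb Q^d\subset\mathcal M$ (or of $\{0,1\}$ where indicated); an `I don't know' AI may also output the symbol $\mathrm{idk}$. Similarly for subsets of $\Omega$. A $\kappa$-trustworthy AI is an `I don't know' AI $\Gamma:\Omega\to\mathbb Q^d\cup\{\mathrm{idk}\}$ such that $\Gamma(\iota)\neq\mathrm{idk}$ implies $\Gamma(\iota)\in B_\kappa(\Xi(\iota))$ (so it halts on every input). An AI with `giving up' parameter is a sequence $\{\Gamma_n\}_{n\in\mathbb N}$ of `I don't know' AIs such that $(\{f_i(\iota)\}_{i=1}^k,n)\mapsto\Gamma_n(\iota)$ is recursive and for every $\iota$ either $\Gamma_n(\iota)=\mathrm{idk}$ for all $n$, or there is $n_\iota$ with $\Gamma_n(\iota)=\mathrm{idk}$ for $n<n_\iota$ and $\Gamma_n(\iota)\ne\mathrm{idk}$ for $n\ge n_\iota$. It is $\kappa$-trustworthy if whenever $\Gamma_n(\iota)\ne\mathrm{idk}$,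 then for all $n'\ge n$ one has $\Gamma_{n'}(\iota)\ne\mathrm{idk}$ and $\Gamma_{n'}(\iota)\in B_\kappa(\Xi(\iota))$. The associated `I don't know' function takes the value $0$ at $\iota$ if the AI outputs $\mathrm{idk}$ on $\iota$ (for every $n$, in the case with giving up parameter) and $1$ otherwise. SCI classes for a function $\Xi^*:\Omega\to\{0,1\}$ (Turing model): $\{\Xi^*,\Omega,\{0,1\},\Lambda\}\in\Delta_0^A$ if there is an algorithm $\Gamma:\Omega\to\{0,1\}$, halting on all inputs, with $\Gamma(\iota)=\Xi^*(\iota)$ for all $\iota\in\Omega$. $\{\Xi^*,\Omega,\{0,1\},\Lambda\}\in\Sigma_1^A$ if there is a sequence of algorithms $\tilde\Gamma_n:\Omega\to\{0,1\}$ such that $(n,\{f_i(\iota)\}_{i=1}^k)\mapsto\tilde\Gamma_n(\iota)$ is recursive and, for every $\iota\in\Omega$, $\tilde\Gamma_n(\iota)$ converges to $\Xi^*(\iota)$ from below, i.e. $\tilde\Gamma_n(\iota)\le\tilde\Gamma_{n+1}(\iota)$ and $\lim_n\tilde\Gamma_n(\iota)=\Xi^*(\iota)$. *)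

(* Defs.v *)
From mathcomp Require Import all_boot all_order all_algebra.
From mathcomp Require Import all_classical all_reals all_analysis.

Set Implicit Arguments.
Unset Strict Implicit.
Unset Printing Implicit Defensive.

Import Order.TTheory GRing.Theory Num.Theory.
Local Open Scope classical_set_scope.
Local Open Scope ring_scope.

(* Deterministic multi-tape Turing machines.  Inputs and outputs are words over
   [bool]; [None] is the blank and [inr] tags auxiliary tape symbols. *)

Definition tape_symbol (work : finType) : Type := option (bool + work).

Inductive move := MoveLeft | Stay | MoveRight.

Record turing_machine := TuringMachine {
  tm_state : finType;
  tm_work : finType;
  tm_tape : finType;
  tm_start : tm_state;
  tm_halt : pred tm_state;
  tm_in : tm_tape;
  tm_out : tm_tape;
  tm_delta : tm_state -> (tm_tape -> tape_symbol tm_work) ->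
             tm_state * (tm_tape -> tape_symbol tm_work * move) }.

(* Tapes are two-way infinite, with cells numbered by [int]. *)
Record config (M : turing_machine) := Config {
  cfg_state : tm_state M;
  cfg_tape : tm_tape M -> int -> tape_symbol (tm_work M);
  cfg_head : tm_tape M -> int }.

Definition move_head (m : move) (z : int) : int :=
  match m with MoveLeft => z - 1 | Stay => z | MoveRight => z + 1 end.

Definition tm_step (M : turing_machine) (c : config M) : config M :=
  if tm_halt (cfg_state c) then c else
  let: (q, act) :=
    tm_delta (cfg_state c) (fun t => cfg_tape c t (cfg_head c t)) in
  Config q
    (fun t z => if z == cfg_head c t then (act t).1 else cfg_tape c t z)
    (fun t => move_head (act t).2 (cfg_head c t)).

(* The tape with [w] in the cells 0, ..., size w - 1 and blanks elsewhere. *)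
Definition word_tape (work : finType) (w : seq bool) (z : int) :
    tape_symbol work :=
  match z with
  | Posz i => omap inl (onth w i)
  | Negz _ => None
  end.

Definition tm_init (M : turing_machine) (w : seq bool) : config M :=
  Config (tm_start M)
    (fun t => if t == tm_in M then word_tape (tm_work M) w else fun=> None)
    (fun=> 0).

Definition tm_computes (M : turing_machine) (w v : seq bool) : Prop :=
  exists n : nat, let c := iter n (@tm_step M) (tm_init M w) in
    tm_halt (cfg_state c) /\ cfg_tape c (tm_out M) =1 word_tape (tm_work M) v.

(* All encodings below are prefix-free, hence uniquely decodable when concatenated;
   natural numbers are written in unary. *)

Definition enc_nat (n : nat) : seq bool := rcons (nseq n true) false.

Definition enc_bool (b : bool) : seq bool := [:: b].

Definition enc_int (z : int) : seq bool := (z < 0) :: enc_nat `|z|%N.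

Definition enc_rat (q : rat) : seq bool :=
  enc_int (numq q) ++ enc_nat `|denq q|%N.

Definition enc_vec (m : nat) (v : 'rV[rat]_m) : seq bool :=
  flatten [seq enc_rat (v 0 i) | i <- enum 'I_m].

(* [None] stands for the output "idk" *)
Definition enc_idk (m : nat) (o : option 'rV[rat]_m) : seq bool :=
  if o is Some v then true :: enc_vec v else [:: false].

(* A machine has access to an input [iota] only through the [Lambda i iota]. *)

Definition enc_input (k : nat) (Omega : Type) (Lambda : 'I_k -> Omega -> rat)
    (iota : Omega) : seq bool :=
  enc_vec (\row_(i < k) Lambda i iota).

Definition algorithm (k : nat) (Omega Y : Type)
    (Lambda : 'I_k -> Omega -> rat) (enc : Y -> seq bool)
    (Gamma : Omega -> Y) : Prop :=
  exists M : turing_machine, forall iota : Omega,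
    tm_computes M (enc_input Lambda iota) (enc (Gamma iota)).

Definition recursive_sequence (k : nat) (Omega Y : Type)
    (Lambda : 'I_k -> Omega -> rat) (enc : Y -> seq bool)
    (Gamma : nat -> Omega -> Y) : Prop :=
  exists M : turing_machine, forall (n : nat) (iota : Omega),
    tm_computes M (enc_nat n ++ enc_input Lambda iota) (enc (Gamma n iota)).

Definition determines_inputs (k : nat) (Omega : Type)
    (Lambda : 'I_k -> Omega -> rat) : Prop :=
  forall iota1 iota2 : Omega,
    iota1 = iota2 <-> (forall i : 'I_k, Lambda i iota1 = Lambda i iota2).

Definition is_metric (R : realType) (T : Type) (dist : T -> T -> R) : Prop :=
  [/\ forall x y, 0 <= dist x y,
      forall x y, dist x y = 0 <-> x = y,
      forall x y, dist x y = dist y x &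
      forall x y z, dist x z <= dist x y + dist y z].

Definition closed_nbhd (R : realType) (T : Type) (dist : T -> T -> R)
    (r : R) (S : set T) : set T :=
  \bigcup_(x in S) [set z | dist z x <= r].

Definition rat_point (R : realType) (d : nat) (v : 'rV[rat]_d) : 'rV[R]_d :=
  map_mx ratr v.

Definition idk_AI (k d : nat) (Omega : Type) (Lambda : 'I_k -> Omega -> rat)
    (Gamma : Omega -> option 'rV[rat]_d) : Prop :=
  algorithm Lambda (@enc_idk d) Gamma.

Definition trustworthy_AI (R : realType) (k d : nat) (Omega : Type)
    (Lambda : 'I_k -> Omega -> rat) (dist : 'rV[R]_d -> 'rV[R]_d -> R)
    (Xi : Omega -> set 'rV[R]_d) (kappa : R)
    (Gamma : Omega -> option 'rV[rat]_d) : Prop :=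
  idk_AI Lambda Gamma /\
  forall (iota : Omega) (v : 'rV[rat]_d), Gamma iota = Some v ->
    closed_nbhd dist kappa (Xi iota) (rat_point R v).

Definition giving_up_AI (k d : nat) (Omega : Type)
    (Lambda : 'I_k -> Omega -> rat)
    (Gamma : nat -> Omega -> option 'rV[rat]_d) : Prop :=
  [/\ forall n, idk_AI Lambda (Gamma n),
      recursive_sequence Lambda (@enc_idk d) Gamma &
      forall iota : Omega,
        (forall n, Gamma n iota = None) \/
        (exists n0 : nat, (forall n, (n < n0)%N -> Gamma n iota = None) /\
                          (forall n, (n0 <= n)%N -> Gamma n iota <> None))].

Definition trustworthy_giving_up_AI (R : realType) (k d : nat) (Omega : Type)
    (Lambda : 'I_k -> Omega -> rat) (dist : 'rV[R]_d -> 'rV[R]_d -> R)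
    (Xi : Omega -> set 'rV[R]_d) (kappa : R)
    (Gamma : nat -> Omega -> option 'rV[rat]_d) : Prop :=
  giving_up_AI Lambda Gamma /\
  forall (iota : Omega) (n : nat), Gamma n iota <> None ->
    forall n' : nat, (n <= n')%N ->
      exists2 v : 'rV[rat]_d, Gamma n' iota = Some v &
        closed_nbhd dist kappa (Xi iota) (rat_point R v).

Definition idk_function (d : nat) (Omega : Type)
    (Gamma : Omega -> option 'rV[rat]_d) (iota : Omega) : bool :=
  ~~ `[< Gamma iota = None >].

Definition giving_up_idk_function (d : nat) (Omega : Type)
    (Gamma : nat -> Omega -> option 'rV[rat]_d) (iota : Omega) : bool :=
  ~~ `[< forall n, Gamma n iota = None >].

Definition Delta0A (k : nat) (Omega : Type) (Lambda : 'I_k -> Omega -> rat)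
    (Xis : Omega -> bool) : Prop :=
  exists2 Gamma : Omega -> bool, algorithm Lambda enc_bool Gamma &
    forall iota, Gamma iota = Xis iota.

(* The limit is taken in the discrete topology of [bool]. *)
Definition Sigma1A (k : nat) (Omega : Type) (Lambda : 'I_k -> Omega -> rat)
    (Xis : Omega -> bool) : Prop :=
  exists Gamma : nat -> Omega -> bool,
    [/\ forall n, algorithm Lambda enc_bool (Gamma n),
        recursive_sequence Lambda enc_bool Gamma,
        forall iota n, (Gamma n iota <= Gamma n.+1 iota)%N &
        forall iota, Gamma n iota @[n --> \oo] --> Xis iota].

Definition Omega1 (Omega : Type) (Xis : Omega -> bool) : Type :=
  {iota : Omega | Xis iota = true}.

Definition restrict_Lambda (k : nat) (Omega : Type)
    (Lambda : 'I_k -> Omega -> rat) (Xis : Omega -> bool)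
    (i : 'I_k) (iota : Omega1 Xis) : rat := Lambda i (sval iota).

Definition solvable_on_Omega1 (R : realType) (k d : nat) (Omega : Type)
    (Lambda : 'I_k -> Omega -> rat) (dist : 'rV[R]_d -> 'rV[R]_d -> R)
    (Xi : Omega -> set 'rV[R]_d) (kappa : R) (Xis : Omega -> bool) : Prop :=
  exists2 Gamma : Omega1 Xis -> 'rV[rat]_d,
    algorithm (restrict_Lambda Lambda (Xis := Xis)) (@enc_vec d) Gamma &
    forall iota : Omega1 Xis,
      closed_nbhd dist kappa (Xi (sval iota)) (rat_point R (Gamma iota)).

(* Main.v *)
(* Whether an output is "idk" can be read off the first bit of its encoding, so
   the idk function is computed by running the given machine and keeping one bit.
   Conversely, [Gamma*] may diverge outside [Omega_1^*], so a machine first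
   evaluates (an approximation from below of) [Xi*] and runs [Gamma*] only on the
   answer 1, which guarantees that the input lies in [Omega_1^*].  From an AI with
   a giving-up parameter, [Gamma*] is obtained by trying n = 0, 1, ... until an
   answer appears, which happens because [Xi*] is 1.

   These machines are while programs over the tapes, compiled to Turing machines
   and analysed by weakest preconditions.  A given machine is run as a subroutine
   on tapes whose visited cells are marked: since its final head positions are
   arbitrary, the marks are what allows one to locate the origin of its output and
   to erase its tapes before the next run. *)

Require Import Defs.
From mathcomp Require Import all_boot all_order all_algebra.
From mathcomp Require Import all_classical all_reals all_analysis.
From mathcomp Require Import zify.

Set Implicit Arguments.
Unset Strict Implicit.
Unset Printing Implicit Defensive.

Import Order.TTheory GRing.Theory Num.Theory.
Local Open Scope classical_set_scope.
Local Open Scope ring_scope.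

(** * Tapes and words written on them *)

Definition tape (W : finType) : Type := ((int -> tape_symbol W) * int)%type.

Section Tape.
Variable W : finType.
Implicit Types (x : tape W) (s : tape_symbol W) (w : seq bool).

Definition read x : tape_symbol W := x.1 x.2.

Definition write (a : tape_symbol W * move) x : tape W :=
  (fun z => if z == x.2 then a.1 else x.1 z, move_head a.2 x.2).

Lemma write_read x mv : write (read x, mv) x = (x.1, move_head mv x.2).
Proof.
by rewrite /write /=; congr (_, _); apply/funext => z; case: eqP => // ->.
Qed.

Lemma write_stay x : write (read x, Stay) x = x.
Proof. by rewrite write_read; case: x. Qed.

Lemma word_tape_nil : word_tape W [::] = fun=> None.
Proof. by apply/funext => -[n|n] /=; rewrite ?onthE ?nth_nil. Qed.

Lemma word_tapeE w (i : nat) : (i < size w)%N ->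
  word_tape W w i%:Z = Some (inl (nth false w i)).
Proof. by move=> hi; rewrite /= onthE (nth_map false). Qed.

Lemma word_tape_size w : word_tape W w (size w)%:Z = None.
Proof. by rewrite /= onthE nth_default ?size_map. Qed.

Lemma word_tape_lt0 w (z : int) : z < 0 -> word_tape W w z = None.
Proof. by case: z. Qed.

Lemma word_tape_rcons w b :
  (fun z => if z == (size w)%:Z then Some (inl b) else word_tape W w z) =
  word_tape W (rcons w b).
Proof.
apply/funext => -[i|//] /=; rewrite eqz_nat !onthE map_rcons nth_rcons size_map.
by case: ltngtP => // hi; rewrite nth_default // size_map ltnW.
Qed.

End Tape.

(** * While programs, their weakest preconditions, and their compilation *)

Section Programs.
Variables T W R : finType.
Notation sym := (tape_symbol W).

(** The finite register [R] becomes part of the control state; it will hold the states of the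
    simulated machines. *)
Definition memory : Type := (R * (T -> tape W))%type.
Implicit Types (m : memory) (Q : memory -> Prop) (b : R -> (T -> sym) -> bool).

Definition scan m (t : T) : sym := read (m.2 t).

Definition effect : Type := (R * (T -> sym * move))%type.

Definition perform (a : effect) m : memory :=
  (a.1, fun t => write (a.2 t) (m.2 t)).

Definition idle (r : R) (s : T -> sym) : effect := (r, fun t => (s t, Stay)).

Lemma perform_idle m : perform (idle m.1 (scan m)) m = m.
Proof.
case: m => r f; rewrite /perform /=; congr (_, _); apply/funext => t.
by rewrite /= write_stay.
Qed.

Inductive prog :=
| Act of R -> (T -> sym) -> effect
| Seq of prog & prog
| If of (R -> (T -> sym) -> bool) & prog & prog
| While of (R -> (T -> sym) -> bool) & prog.

(** The extra [None] in [If] and [While] is the test, a step of its own that leaves the tapes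
    unchanged. For [While], the [None] by which the body signals termination is literally the
    counter of the test, so the body loops back without a translation. *)
Fixpoint pc (p : prog) : finType :=
  match p with
  | Act _ => unit
  | Seq p q => (pc p + pc q)%type
  | If _ p q => option (pc p + pc q)
  | While _ p => option (pc p)
  end.

Fixpoint entry (p : prog) : pc p :=
  match p with
  | Act _ => tt
  | Seq p _ => inl (entry p)
  | If _ _ _ => None
  | While _ _ => None
  end.

(* The next program counter is [None] when the program terminates. *)
Fixpoint next (p : prog) :
    pc p -> R -> (T -> sym) -> option (pc p) * effect :=
  match p return pc p -> R -> (T -> sym) -> option (pc p) * effect with
  | Act f => fun _ r s => (None, f r s)
  | Seq p q => fun c r s =>
      match c with
      | inl c => let: (o, a) := next c r s in
                 (Some (if o is Some c' then inl c' else inr (entry q)), a)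
      | inr c => let: (o, a) := next c r s in (omap inr o, a)
      end
  | If b p q => fun c r s =>
      match c with
      | None => (Some (Some (if b r s then inl (entry p) else inr (entry q))),
                 idle r s)
      | Some (inl c) => let: (o, a) := next c r s in (omap (Some \o inl) o, a)
      | Some (inr c) => let: (o, a) := next c r s in (omap (Some \o inr) o, a)
      end
  | While b p => fun c r s =>
      match c with
      | None => (if b r s then Some (Some (entry p)) else None, idle r s)
      | Some c => let: (o, a) := next c r s in (Some o, a)
      end
  end.

Inductive exits (p : prog) : pc p -> memory -> memory -> Prop :=
| Exits_now c m a : next c m.1 (scan m) = (None, a) ->
    exits c m (perform a m)
| Exits_later c c' m m' a : next c m.1 (scan m) = (Some c', a) ->
    exits c' (perform a m) m' -> exits c m m'.

(** Total correctness: [exits] is inductive, so termination is included, and programs are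
    deterministic, so one terminating run suffices. *)
Definition wp p Q m := exists2 m', exits (entry p) m m' & Q m'.

Lemma wp_mono p Q Q' m : wp p Q m -> (forall m', Q m' -> Q' m') -> wp p Q' m.
Proof. by move=> [m' e q] h; exists m' => //; apply: h. Qed.

Lemma wp_act f Q m : Q (perform (f m.1 (scan m)) m) -> wp (Act f) Q m.
Proof. by move=> q; eexists; last exact: q; apply: Exits_now. Qed.

Lemma exits_seqr p q (c : pc q) m1 m2 :
  exits c m1 m2 -> exits (inr c : pc (Seq p q)) m1 m2.
Proof.
elim=> {c m1 m2} [c m a hn|c c' m m' a hn _ ih].
- by apply: Exits_now; rewrite /= hn.
- by apply: (Exits_later _ ih); rewrite /= hn.
Qed.

Lemma exits_seql p q (c : pc p) m1 m2 m3 :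
  exits c m1 m2 -> exits (entry q) m2 m3 ->
  exits (inl c : pc (Seq p q)) m1 m3.
Proof.
move=> e1 e2; elim: e1 e2 => {c m1 m2} [c m a hn|c c' m m' a hn _ ih] e2.
- by apply: (Exits_later _ (exits_seqr p e2)); rewrite /= hn.
- by apply: (Exits_later _ (ih e2)); rewrite /= hn.
Qed.

Lemma wp_seq p q Q m : wp p (wp q Q) m -> wp (Seq p q) Q m.
Proof. by move=> [m1 e1 [m2 e2 h]]; exists m2 => //; apply: exits_seql e1 e2. Qed.

Lemma wp_if b p q Q m : wp (if b m.1 (scan m) then p else q) Q m ->
  wp (If b p q) Q m.
Proof.
move=> [m' e h]; exists m' => //.
apply: (@Exits_later (If b p q) _ (Some (if b m.1 (scan m) then inl (entry p)
  else inr (entry q))) _ _ (idle m.1 (scan m))) => //.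
rewrite perform_idle; case: (b _ _) e => e.
all: elim: e => {h} [c {}m a hn|c c' {}m {}m' a hn _ ih];
  [by apply: Exits_now; rewrite /= hn|by apply: (Exits_later _ ih); rewrite /= hn].
Qed.

Lemma exits_while b p (c : pc p) m1 m2 m3 :
  exits c m1 m2 -> exits (None : pc (While b p)) m2 m3 ->
  exits (Some c : pc (While b p)) m1 m3.
Proof.
move=> e1 e2; elim: e1 e2 => {c m1 m2} [c m a hn|c c' m m' a hn _ ih] e2.
- by apply: (Exits_later _ e2); rewrite /= hn.
- by apply: (Exits_later _ (ih e2)); rewrite /= hn.
Qed.

(** Loops have no invariant rule: one turn is unfolded at a time, inside an induction on the number
    of turns left. *)
Lemma wp_while_true b p Q m : b m.1 (scan m) ->
  wp p (wp (While b p) Q) m -> wp (While b p) Q m.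
Proof.
move=> hb [m1 e1 [m2 e2 h]]; exists m2 => //.
apply: (@Exits_later (While b p) _ (Some (entry p)) _ _ (idle m.1 (scan m))).
  by rewrite /= hb.
by rewrite perform_idle; apply: exits_while e1 e2.
Qed.

Lemma wp_while_false b p Q m : ~~ b m.1 (scan m) -> Q m -> wp (While b p) Q m.
Proof.
move=> hb q; exists m => //; rewrite -{2}(perform_idle m).
by apply: Exits_now; rewrite /= (negbTE hb).
Qed.

Definition machine (p : prog) (r0 : R) (tin tout : T) : turing_machine :=
  @TuringMachine (option (pc p) * R)%type W T (Some (entry p), r0)
    (fun q => q.1 == None) tin tout
    (fun q s => if q.1 is Some c then
                  let: (o, a) := next c q.2 s in ((o, a.1), a.2)
                else (q, fun t => (s t, Stay))).

Definition config_of p r0 tin tout (o : option (pc p)) m :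
    config (machine p r0 tin tout) :=
  @Config (machine p r0 tin tout) (o, m.1)
    (fun t => (m.2 t).1) (fun t => (m.2 t).2).

Lemma exits_iter p r0 tin tout (c : pc p) m m' : exits c m m' ->
  exists n, iter n (@tm_step _) (config_of r0 tin tout (Some c) m) =
            config_of r0 tin tout None m'.
Proof.
elim=> {c m m'} [c m a hn|c c' m m' a hn _ [n ih]].
- by exists 1%N; rewrite /= /tm_step /= hn.
- exists n.+1; rewrite iterSr -ih; congr iter.
  by rewrite /tm_step /= hn.
Qed.

(** The passage from programs to Turing machines: one program step is one machine step. Only the
    contents of the output tape matter, not the final heads. *)
Lemma wp_computes p r0 tin tout w v :
  wp p (fun m => (m.2 tout).1 = word_tape W v)
    (r0, fun t => (if t == tin then word_tape W w else fun=> None, 0)) ->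
  tm_computes (machine p r0 tin tout) w v.
Proof.
move=> [m /(exits_iter r0 tin tout) [n hn] hv]; exists n.
have -> : tm_init (machine p r0 tin tout) w = config_of r0 tin tout
    (Some (entry p)) (r0, fun t => (if t == tin then word_tape W w else fun=> None, 0)).
  by [].
by rewrite hn; split=> //= z; rewrite hv.
Qed.

End Programs.

(** * Elementary programs on a single tape *)

Definition is_bit (W : finType) (b : bool) (s : tape_symbol W) : bool :=
  if s is Some (inl b') then b' == b else false.

Section SingleTape.
Variables T W R : finType.
Notation sym := (tape_symbol W).
Notation memory := (memory T W R).
Notation prog := (prog T W R).
Implicit Types (m : memory) (Q : memory -> Prop) (p : prog) (t : T) (x : tape W).

Definition set_tape m t x : memory := (m.1, fun t' => if t' == t then x else m.2 t').

Lemma set_tape_eq m t x : (set_tape m t x).2 t = x.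
Proof. by rewrite /= eqxx. Qed.

Lemma set_tape_ne m t x t' : t' != t -> (set_tape m t x).2 t' = m.2 t'.
Proof. by move=> /negbTE h; rewrite /= h. Qed.

Lemma set_tape_set m t x y : set_tape (set_tape m t x) t y = set_tape m t y.
Proof.
by rewrite /set_tape /=; congr (_, _); apply/funext => t'; case: eqP.
Qed.

Lemma set_tape_id m t : set_tape m t (m.2 t) = m.
Proof.
case: m => r f; rewrite /set_tape /=; congr (_, _); apply/funext => t'.
by case: eqP => // ->.
Qed.

Definition act_on t (g : (T -> sym) -> sym * move) : prog :=
  Act (fun r s => (r, fun t' => if t' == t then g s else (s t', Stay))).

Lemma wp_act_on t g Q m :
  Q (set_tape m t (write (g (scan m)) (m.2 t))) -> wp (act_on t g) Q m.
Proof.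
move=> q; apply: wp_act; move: q; congr Q; rewrite /set_tape /perform /=.
by congr (_, _); apply/funext => t'; case: eqP => [->//|_]; rewrite write_stay.
Qed.

Definition go t mv : prog := act_on t (fun s => (s t, mv)).

Lemma wp_go t mv Q m :
  Q (set_tape m t ((m.2 t).1, move_head mv (m.2 t).2)) -> wp (go t mv) Q m.
Proof. by move=> q; apply: wp_act_on; rewrite write_read. Qed.

Definition sweep t mv (P : sym -> bool) : prog :=
  While (fun _ s => P (s t)) (go t mv).

Lemma wp_sweep t mv (P : sym -> bool) n Q m :
  (forall i, (i < n)%N -> P ((m.2 t).1 (iter i (move_head mv) (m.2 t).2))) ->
  ~~ P ((m.2 t).1 (iter n (move_head mv) (m.2 t).2)) ->
  Q (set_tape m t ((m.2 t).1, iter n (move_head mv) (m.2 t).2)) ->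
  wp (sweep t mv P) Q m.
Proof.
elim: n m => [|n ih] m hP hn q.
  by apply: wp_while_false => //; move: q; rewrite -surjective_pairing set_tape_id.
apply: wp_while_true; first exact: (hP 0%N).
apply: wp_go; apply: ih; rewrite set_tape_eq /= -?iterSr //.
  by move=> i hi; rewrite -iterSr; apply: hP.
by rewrite set_tape_set.
Qed.

Lemma iter_left n z : iter n (move_head MoveLeft) z = z - n%:Z.
Proof. by elim: n => /= [|n ->]; lia. Qed.

Lemma iter_right n z : iter n (move_head MoveRight) z = z + n%:Z.
Proof. by elim: n => /= [|n ->]; lia. Qed.

(** The head may stand on the blank just after the word, where the sweep would stop at once; hence
    the first move to the left. The sweep ends in cell -1, which the last move corrects. *)
Definition rewind t : prog :=
  Seq (go t MoveLeft) (Seq (sweep t MoveLeft isSome) (go t MoveRight)).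

Lemma wp_rewind t w (i : nat) Q m : (i <= size w)%N ->
  m.2 t = (word_tape W w, i%:Z) -> Q (set_tape m t (word_tape W w, 0)) ->
  wp (rewind t) Q m.
Proof.
move=> hi hm q; apply: wp_seq; apply: wp_go; apply: wp_seq.
apply: (@wp_sweep _ _ _ i); rewrite set_tape_eq hm /= ?iter_left.
- move=> j hj; rewrite iter_left.
  have -> : i%:Z - 1 - j%:Z = (i - j.+1)%N%:Z by lia.
  by rewrite word_tapeE //; lia.
- by rewrite word_tape_lt0 //; lia.
- apply: wp_go; rewrite set_tape_set set_tape_eq set_tape_set /=.
  by have -> : i%:Z - 1 - i%:Z + 1 = 0 by lia.
Qed.

Definition strip_nat t : prog :=
  Seq (sweep t MoveRight (is_bit true)) (go t MoveRight).

Lemma wp_strip_nat t n w Q m : m.2 t = (word_tape W (enc_nat n ++ w), 0) ->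
  Q (set_tape m t (word_tape W (enc_nat n ++ w), n.+1%:Z)) ->
  wp (strip_nat t) Q m.
Proof.
move=> hm q.
have hs : size (enc_nat n ++ w) = (n.+1 + size w)%N.
  by rewrite size_cat size_rcons size_nseq.
have hnth i : (i <= n)%N -> nth false (enc_nat n ++ w) i = (i < n)%N.
  move=> hi; rewrite nth_cat size_rcons size_nseq ltnS hi nth_rcons size_nseq.
  rewrite nth_nseq; case: ltngtP hi => //.
apply: wp_seq; apply: (@wp_sweep _ _ _ n);
  rewrite hm ![(_, _).1]/= ![(_, _).2]/= ?iter_right ?add0r.
- move=> i hi; rewrite iter_right add0r word_tapeE ?hs; last by lia.
  by rewrite hnth ?hi // ltnW.
- by rewrite word_tapeE ?hs ?hnth ?ltnn //; lia.
- apply: wp_go; rewrite set_tape_set set_tape_eq /=.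
  by have -> : n%:Z + 1 = n.+1%:Z by lia.
Qed.

End SingleTape.

Arguments act_on {T W R}.
Arguments go {T W R}.
Arguments sweep {T W R}.
Arguments rewind {T W R}.
Arguments strip_nat {T W R}.

(** * Running a given machine as a subroutine *)

Definition relay (W W' : finType) (s : tape_symbol W) : tape_symbol W' :=
  if s is Some (inl b) then Some (inl b) else None.

Section Simulation.
Variables T W R : finType.
Notation sym := (tape_symbol W).
Notation memory := (memory T W R).
Notation prog := (prog T W R).
Variable M : turing_machine.
Notation msym := (tape_symbol (tm_work M)).
Variables (e : tm_tape M -> T) (inv : T -> option (tm_tape M)).
Hypothesis eK : pcancel e inv.
Variables (c : msym * bool -> W) (dc : W -> msym * bool).
Hypothesis cK : cancel c dc.
Variables (get : R -> tm_state M) (put : R -> tm_state M -> R).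
Hypothesis putK : forall r q, get (put r q) = q.
Implicit Types (m : memory) (Q : memory -> Prop) (t : T) (x : tape W).
Implicit Types (f : int -> msym) (u v w : seq bool).

(* A visited cell of a simulated tape stores a symbol of [M] together with a
   flag that marks the origin; [None] means that the cell was never visited. *)
Definition dec (s : sym) : msym * bool :=
  if s is Some (inr a) then dc a else (None, false).

(** The flag of the overwritten cell is kept, so the origin mark survives every write. A blank
    written by [M] is stored as a nonblank symbol, so the cell still counts as visited. *)
Definition enc (a : msym) (s : sym) : sym := Some (inr (c (a, (dec s).2))).

(* The simulated tape is known only up to the translation by [off]; the visited
   cells form the interval from [lo] to [hi]. *)
Definition simulates f (h : int) x : Prop :=
  exists off lo hi : int, [/\ x.2 = h + off,
    forall z, dec (x.1 (z + off)) = (f z, z == 0),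
    forall z, x.1 z = (lo <= z <= hi) :> bool &
    lo - 1 <= x.2 <= hi + 1].

Lemma simulates_read f h x : simulates f h x -> dec (read x) = (f h, h == 0).
Proof. by move=> [off [lo [hi [hx hd _ _]]]]; rewrite /read hx hd. Qed.

Lemma simulates_write f h x a mv : simulates f h x ->
  simulates (fun z => if z == h then a else f z) (move_head mv h)
    (write (enc a (read x), mv) x).
Proof.
move=> hs; have hr := simulates_read hs.
case: hs => off [lo [hi [hx hd hv hb]]].
(* The head is inside the visited interval or adjacent to it, so adding the written cell gives an
   interval again. *)
exists off, (Num.min lo x.2), (Num.max hi x.2); split=> /=.
- by rewrite hx; case: mv => /=; lia.
- move=> z; rewrite hx (inj_eq (addIr _)); case: eqP => [->|_] //.
  by rewrite /= cK hr.
- move=> z; case: eqP => [->|h0] /=; first by lia.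
  by rewrite hv; lia.
- by case: mv => /=; lia.
Qed.

Lemma simulates_move f h x mv : read x -> simulates f h x ->
  simulates f (move_head mv h) (x.1, move_head mv x.2).
Proof.
move=> hr [off [lo [hi [hx hd hv hb]]]]; exists off, lo, hi; split=> //=.
- by rewrite hx; case: mv => /=; lia.
- by move: hr; rewrite /read hv; case: mv => /=; lia.
Qed.

(** The head may be one cell outside the visited interval; marking that cell as visited brings it
    inside, without changing the simulated tape. *)
Definition touch t : prog := act_on t (fun s => (enc (dec (s t)).1 (s t), Stay)).

Lemma wp_touch t f h Q m : simulates f h (m.2 t) ->
  (forall x, simulates f h x -> read x -> Q (set_tape m t x)) ->
  wp (touch t) Q m.
Proof.
move=> hs q; apply: wp_act_on; apply: q; last by rewrite /read /= eqxx.
have := simulates_write (dec (scan m t)).1 Stay hs.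
rewrite (simulates_read hs) /=; congr (simulates _ _ _).
by apply/funext => z; case: eqP => // ->.
Qed.

Definition leftmost t : prog :=
  Seq (touch t) (Seq (sweep t MoveLeft isSome) (go t MoveRight)).

Lemma wp_leftmost t f h Q m : simulates f h (m.2 t) ->
  (forall (g : int -> sym) (off lo hi : int),
     (forall z, dec (g (z + off)) = (f z, z == 0)) ->
     (forall z, g z = (lo <= z <= hi) :> bool) -> lo <= hi ->
     Q (set_tape m t (g, lo))) ->
  wp (leftmost t) Q m.
Proof.
move=> hs q; apply: wp_seq; apply: (wp_touch hs) => x.
move=> [off [lo [hi [hx hd hv _]]]] hr; rewrite /read hv in hr.
have [n hn] : exists n : nat, x.2 = lo + n%:Z.
  by exists (absz (x.2 - lo)); lia.
(* The sweep stops on the first unvisited cell [lo - 1], which is [n.+1] cells to the left. *)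
apply: wp_seq; apply: (@wp_sweep _ _ _ _ _ _ n.+1); rewrite set_tape_eq ?iter_left.
- by move=> i hi'; rewrite iter_left hv; lia.
- by rewrite hv; lia.
- apply: wp_go; rewrite set_tape_set set_tape_eq set_tape_set [move_head _ _]/=.
  have -> : x.2 - n.+1%:Z + 1 = lo by lia.
  by apply: (q _ off _ hi) => //; lia.
Qed.

(** The origin may lie on either side of the head, so the search starts from the left end of the
    visited interval. *)
Definition seek_origin t : prog :=
  Seq (leftmost t) (sweep t MoveRight (fun s => ~~ (dec s).2)).

Lemma wp_seek_origin t f h Q m : simulates f h (m.2 t) ->
  (forall x, simulates f 0 x -> Q (set_tape m t x)) -> wp (seek_origin t) Q m.
Proof.
move=> hs q; apply: wp_seq; apply: (wp_leftmost hs) => g off lo hi hd hv hlh.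
(* The origin carries a flag and unvisited cells carry none, so the origin has been visited. *)
have hoff : lo <= off <= hi.
  rewrite -hv; move: (hd 0); rewrite add0r eqxx.
  by case: (g off) => //; rewrite /dec.
apply: (@wp_sweep _ _ _ _ _ _ (absz (off - lo))); rewrite set_tape_eq /=.
- move=> i hi'; rewrite iter_right.
  by rewrite (_ : _ + _ = (lo + i%:Z - off) + off) ?hd /=; lia.
- by rewrite iter_right (_ : _ + _ = 0 + off) ?hd //; lia.
- rewrite set_tape_set iter_right; apply: q; exists off, lo, hi; split=> //=; lia.
Qed.

Definition clean t : prog :=
  Seq (leftmost t) (While (fun _ s => isSome (s t))
                          (act_on t (fun=> (None, MoveRight)))).

Lemma wp_clean t f h Q m : simulates f h (m.2 t) ->
  (forall z, Q (set_tape m t (fun=> None, z))) -> wp (clean t) Q m.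
Proof.
move=> hs q; apply: wp_seq; apply: (wp_leftmost hs) => g off lo hi _ hv hlh.
have [n hn] : exists n : nat, (hi + 1)%R = (lo + n%:Z)%R :> int.
  by exists (absz (hi + 1 - lo)%R); lia.
(* In half-open form the interval may be empty, which is the base case of the induction on the
   number of cells left to erase. *)
have {}hv z : g z = (lo <= z < lo + n%:Z) :> bool by rewrite hv; lia.
clear hn hlh.
elim: n lo g hv => [|n ih] lo g hv.
  apply: wp_while_false; first by rewrite /scan set_tape_eq hv /=; lia.
  suff -> : g = fun=> None by [].
  by apply/funext => z; have := hv z; case: (g z) => //= a; lia.
apply: wp_while_true; first by rewrite /scan set_tape_eq hv /=; lia.
apply: wp_act_on; rewrite set_tape_eq set_tape_set; apply: ih => z /=.
by case: eqP => [->|h0]; rewrite /= ?hv; lia.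
Qed.

Definition skip : prog := Act (@idle T W R).

Lemma wp_skip Q m : Q m -> wp skip Q m.
Proof. by move=> q; apply: wp_act; rewrite perform_idle. Qed.

Definition clean_all : prog :=
  foldr (fun i p => Seq (clean (e i)) p) skip (enum (tm_tape M)).

(** The frame condition of a subroutine: the caller's tapes survive, heads included. *)
Definition agree m m' := forall t, inv t = None -> m'.2 t = m.2 t.

Lemma inv_e i t : inv t = None -> t != e i.
Proof. by move=> h; apply/eqP => ht; move: h; rewrite ht eK. Qed.

Lemma e_inj : injective e.
Proof. exact: pcan_inj eK. Qed.

(** The heads are left free because [clean] stops wherever the visited interval ends. *)
Definition blank m := forall i, exists h, m.2 (e i) = (fun=> None, h).

Lemma wp_clean_all Q m : (forall i, exists f h, simulates f h (m.2 (e i))) ->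
  (forall m', blank m' -> agree m m' -> Q m') -> wp clean_all Q m.
Proof.
move=> hs q; rewrite /clean_all.
(* Generalised to a list [l] of tapes still to be cleaned; those outside [l] are already blank. *)
suff H l m' : uniq l -> agree m m' ->
    (forall i, i \notin l -> exists h, m'.2 (e i) = (fun=> None, h)) ->
    (forall i, i \in l -> exists f h, simulates f h (m'.2 (e i))) ->
    wp (foldr (fun i p => Seq (clean (e i)) p) skip l) Q m'.
  by apply: H => // [|i]; [exact: enum_uniq|rewrite mem_enum].
elim: l m' => {hs} [|i l ih] m' /=.
  by move=> _ ha hb _; apply: wp_skip; apply: q => // i; apply: hb.
move=> /andP[hi hl] ha hb hs; apply: wp_seq.
have [|f [h /wp_clean]] := hs i; first exact: mem_head.
apply=> z; apply: ih => //.
- by move=> t ht; rewrite set_tape_ne ?ha ?inv_e.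
- move=> j hj; case: (eqVneq j i) => [->|ji].
    by exists z; rewrite set_tape_eq.
  rewrite set_tape_ne ?(inj_eq e_inj) //; apply: hb.
  by rewrite inE negb_or ji.
- move=> j hj; rewrite set_tape_ne ?(inj_eq e_inj).
    by apply: hs; rewrite inE hj orbT.
  by apply: contraNneq hi => <-.
Qed.

(** The cell under each head is declared the origin, so blank tapes can be reused wherever their
    heads were left. *)
Definition initialize : prog :=
  Act (fun r s => (put r (tm_start M),
    fun t => (if inv t is Some _ then Some (inr (c (None, true))) else s t, Stay))).

(* [M] in its initial state, with [w] written so far on its input tape. *)
Definition loading w m : Prop :=
  [/\ get m.1 = tm_start M,
      simulates (word_tape (tm_work M) w) (size w)%:Z (m.2 (e (tm_in M))) &
      forall i, i != tm_in M -> simulates (fun=> None) 0 (m.2 (e i))].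

Lemma wp_initialize Q m : blank m ->
  (forall m', loading [::] m' -> agree m m' -> Q m') -> wp initialize Q m.
Proof.
move=> hb q; apply: wp_act.
have hs i : simulates (fun=> None) 0 ((perform (put m.1 (tm_start M),
    fun t => (if inv t is Some _ then Some (inr (c (None, true))) else scan m t,
      Stay)) m).2 (e i)).
  rewrite /= eK; have [h ->] := hb i.
  exists h, h, h; split=> //=; first by rewrite add0r.
  - move=> z; have -> : (z + h == h) = (z == 0) by lia.
    by case: eqP => //= _; rewrite cK.
  - by move=> z; case: eqP => [->|] /=; lia.
  - by lia.
apply: q.
- by split=> [||i _]; rewrite ?putK ?word_tape_nil //; apply: hs.
- by move=> t ht; rewrite /= ht write_stay.
Qed.

Definition running (k : config M) m : Prop :=
  get m.1 = cfg_state k /\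
  forall i, simulates (cfg_tape k i) (cfg_head k i) (m.2 (e i)).

Definition run : prog :=
  While (fun r _ => ~~ tm_halt (get r))
    (Act (fun r s =>
      let a := tm_delta (get r) (fun i => (dec (s (e i))).1) in
      (put r a.1, fun t => if inv t is Some i
                           then (enc (a.2 i).1 (s t), (a.2 i).2)
                           else (s t, Stay)))).

Lemma wp_run n k Q m : running k m ->
  tm_halt (cfg_state (iter n (@tm_step M) k)) ->
  (forall m', running (iter n (@tm_step M) k) m' -> agree m m' -> Q m') ->
  wp run Q m.
Proof.
elim: n k m => [|n ih] k m [hg hs] hh q.
  by apply: wp_while_false; [rewrite hg hh|apply: q].
have [hk|hk] := boolP (tm_halt (cfg_state k)).
  (* Halting configurations are fixed by [tm_step], so the loop may stop before [n] steps have been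
     made. *)
  have hit : iter n.+1 (@tm_step M) k = k.
    by elim: n.+1 => //= j ->; rewrite /tm_step hk.
  by apply: wp_while_false; [rewrite hg hk|apply: q; rewrite ?hit].
apply: wp_while_true; first by rewrite hg.
have hscan : (fun i => (dec (scan m (e i))).1) =
    fun i => cfg_tape k i (cfg_head k i).
  by apply/funext => i; rewrite (simulates_read (hs i)).
rewrite iterSr in hh q.
apply: wp_act; apply: (ih (tm_step k)) => //.
- rewrite /tm_step (negbTE hk) hg hscan.
  case: (tm_delta _ _) => q' a; split=> [|i]; first by rewrite putK.
  by rewrite /= eK; apply: simulates_write.
- move=> m' hr ha; apply: q => // t ht; rewrite ha //= ht.
  by rewrite write_stay.
Qed.

Definition feed_bit t : prog :=
  Seq (act_on (e (tm_in M)) (fun s =>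
         (enc (relay (tm_work M) (s t)) (s (e (tm_in M))), MoveRight)))
      (go t MoveRight).

Definition feed t : prog :=
  Seq (While (fun _ s => isSome (s t)) (feed_bit t)) (rewind t).

Lemma loading_rcons u b m m' : loading u m ->
  m'.1 = m.1 -> m'.2 (e (tm_in M)) =
    write (enc (Some (inl b)) (read (m.2 (e (tm_in M)))), MoveRight)
      (m.2 (e (tm_in M))) ->
  (forall i, i != tm_in M -> m'.2 (e i) = m.2 (e i)) -> loading (rcons u b) m'.
Proof.
move=> [h1 h2 h3] e1 e2 e3; split; first by rewrite e1.
  rewrite e2 -word_tape_rcons size_rcons.
  have -> : (size u).+1%:Z = move_head MoveRight (size u)%:Z by rewrite /=; lia.
  exact: simulates_write.
by move=> i hi; rewrite e3 //; apply: h3.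
Qed.

(** The start position [i] and the prefix [u] drive the induction. They also let an input be
    assembled from several tapes, and let a leading part of a tape be skipped. The source is rewound
    so that it can be fed again. *)
Lemma wp_feed t u w (i : nat) Q m : inv t = None -> (i <= size w)%N ->
  m.2 t = (word_tape W w, i%:Z) -> loading u m ->
  (forall m', loading (u ++ drop i w) m' -> m'.2 t = (word_tape W w, 0) ->
    (forall t', inv t' = None -> t' != t -> m'.2 t' = m.2 t') -> Q m') ->
  wp (feed t) Q m.
Proof.
move=> ht hi hm hl q; apply: wp_seq.
have [n hn] : exists n, (size w - i)%N = n by eexists.
elim: n i u m hi hn hm hl q => [|n ih] i u m hi hn hm hl q.
  have hiw : i = size w by lia.
  apply: wp_while_false; first by rewrite /scan hm hiw [read _]word_tape_size.
  apply: (wp_rewind hi hm); apply: q.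
  - rewrite hiw drop_size cats0; case: hl => h1 h2 h3.
    by split=> // [|j hj]; rewrite set_tape_ne 1?eq_sym ?inv_e //; apply: h3.
  - by rewrite set_tape_eq.
  - by move=> t' _ h; rewrite set_tape_ne.
have hiw : (i < size w)%N by lia.
have hr : scan m t = Some (inl (nth false w i)).
  by rewrite /scan hm [read _]word_tapeE.
apply: wp_while_true; first by rewrite hr.
apply: wp_seq; apply: wp_act_on; apply: wp_go.
have te := inv_e (tm_in M) ht; have et := te; rewrite eq_sym in et.
apply: (ih i.+1 (rcons u (nth false w i))) => //; first by lia.
- by rewrite set_tape_eq set_tape_ne // hm /=; congr (_, _); lia.
- apply: (loading_rcons hl) => //.
    by rewrite set_tape_ne // set_tape_eq hr.
  by move=> j hj; rewrite !set_tape_ne ?(inj_eq e_inj) // eq_sym inv_e.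
- move=> m' hl' hm' ha; apply: q => //.
    by rewrite (drop_nth false) // -cat_rcons.
  by move=> t' ht' h; rewrite ha // !set_tape_ne ?inv_e.
Qed.

Definition feed_const b : prog :=
  act_on (e (tm_in M)) (fun s => (enc (Some (inl b)) (s (e (tm_in M))), MoveRight)).

Lemma wp_feed_const b u Q m : loading u m ->
  (forall m', loading (rcons u b) m' -> agree m m' -> Q m') ->
  wp (feed_const b) Q m.
Proof.
move=> hl q; apply: wp_act_on; apply: q.
  apply: (loading_rcons hl) => //; first by rewrite set_tape_eq.
  by move=> j hj; rewrite set_tape_ne // (inj_eq e_inj).
by move=> t ht; rewrite set_tape_ne // inv_e.
Qed.

Definition finished v m : Prop :=
  simulates (word_tape (tm_work M) v) 0 (m.2 (e (tm_out M))) /\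
  forall i, exists f h, simulates f h (m.2 (e i)).

(** The loader [p] leaves the input head after the input, while [M] expects it at 0; the other heads
    have not moved. After the run only the output head has to be located. *)
Definition call (p : prog) : prog :=
  Seq initialize (Seq p (Seq (seek_origin (e (tm_in M)))
    (Seq run (seek_origin (e (tm_out M)))))).

(** The rest of the computation enters through the postcondition of [p], because the run preserves
    the caller's tapes as [p] left them. *)
Lemma wp_call p u v Q m : tm_computes M u v -> blank m ->
  (forall m1, loading [::] m1 -> agree m m1 ->
    wp p (fun m2 => loading u m2 /\
      forall m3, finished v m3 -> agree m2 m3 -> Q m3) m1) ->
  wp (call p) Q m.
Proof.
move=> [n [hh hv]] hb hp; apply: wp_seq; apply: wp_initialize => // m1 hl1 ha1.
apply: wp_seq; apply: (wp_mono (hp _ hl1 ha1)) => m2 [[h1 h2 h3] q].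
apply: wp_seq; apply: (wp_seek_origin h2) => x hx.
apply: wp_seq; apply: (@wp_run n (tm_init M u)) => //.
  split=> // i; rewrite [cfg_tape _ _]/=.
  case: (eqVneq i (tm_in M)) => [->|hi]; first by rewrite set_tape_eq.
  by rewrite set_tape_ne ?(inj_eq e_inj) //; apply: h3.
move=> m3 [_ hs] ha.
apply: (wp_seek_origin (hs _)) => y hy; apply: q.
  split=> [|i]; first by rewrite set_tape_eq -(funext hv).
  case: (eqVneq i (tm_out M)) => [->|hi].
    by rewrite set_tape_eq; do 2 eexists; exact: hy.
  by rewrite set_tape_ne ?(inj_eq e_inj) //; do 2 eexists; exact: hs.
by move=> t ht; rewrite set_tape_ne ?inv_e // ha // set_tape_ne ?inv_e.
Qed.

Definition copy_bit t : prog :=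
  Seq (act_on t (fun s => (relay W (dec (s (e (tm_out M)))).1, MoveRight)))
      (go (e (tm_out M)) MoveRight).

(** The test is on the decoded symbol: [M] may have visited cells after its output and left them
    blank. *)
Definition copy_out t : prog :=
  While (fun _ s => isSome (dec (s (e (tm_out M)))).1) (copy_bit t).

Lemma wp_copy_bit t u v (i : nat) Q m : inv t = None -> (i < size v)%N ->
  simulates (word_tape (tm_work M) v) i%:Z (m.2 (e (tm_out M))) ->
  m.2 t = (word_tape W u, (size u)%:Z) ->
  (forall m', simulates (word_tape (tm_work M) v) i.+1%:Z (m'.2 (e (tm_out M))) ->
    m'.2 t = (word_tape W (rcons u (nth false v i)), (size u).+1%:Z) -> Q m') ->
  wp (copy_bit t) Q m.
Proof.
move=> ht hi hs hm q.
have te := inv_e (tm_out M) ht; have et := te; rewrite eq_sym in et.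
have hr := simulates_read hs; rewrite word_tapeE // in hr.
apply: wp_seq; apply: wp_act_on; apply: wp_go; apply: q.
  rewrite set_tape_eq set_tape_ne //.
  have -> : i.+1%:Z = move_head MoveRight i%:Z by rewrite /=; lia.
  by apply: simulates_move => //; case: (read _) hr.
rewrite set_tape_ne // set_tape_eq hm /write /scan hr /= word_tape_rcons.
by congr (_, _); lia.
Qed.

Lemma wp_copy_out t u v (i : nat) Q m : inv t = None -> (i <= size v)%N ->
  simulates (word_tape (tm_work M) v) i%:Z (m.2 (e (tm_out M))) ->
  m.2 t = (word_tape W u, (size u)%:Z) ->
  (forall m', (m'.2 t).1 = word_tape W (u ++ drop i v) -> Q m') ->
  wp (copy_out t) Q m.
Proof.
have [n hn] : exists n, (size v - i)%N = n by eexists.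
elim: n i u m hn => [|n ih] i u m hn ht hi hs hm q.
  have hiv : i = size v by lia.
  apply: wp_while_false; last by apply: q; rewrite hm hiv drop_size cats0.
  by rewrite (simulates_read hs) hiv word_tape_size.
have hiv : (i < size v)%N by lia.
apply: wp_while_true; first by rewrite (simulates_read hs) word_tapeE.
apply: (wp_copy_bit ht hiv hs hm) => m' hs' hm'.
apply: (ih i.+1 (rcons u (nth false v i))) => //; first by lia.
  by rewrite size_rcons.
by move=> m'' h; apply: q; rewrite h (drop_nth false hiv) -cat_rcons.
Qed.

End Simulation.

(** * Machines built from one machine: truncated outputs and unbounded search *)

Section OneMachine.
Variable M : turing_machine.

Let T : finType := (option bool + tm_tape M)%type.
Let W : finType := (option (bool + tm_work M) * bool)%type.
Let tin : T := inl None.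
Let tout : T := inl (Some false).
Let tcnt : T := inl (Some true).
Let e (i : tm_tape M) : T := inr i.
Let inv (t : T) := if t is inr i then Some i else None.
Let c (a : W) : W := a.
Let get (q : tm_state M) := q.
Let put (_ q : tm_state M) := q.

Let eK : pcancel e inv. Proof. by []. Qed.
Let cK : cancel c c. Proof. by []. Qed.
Let putK r q : get (put r q) = q. Proof. by []. Qed.

Notation feed := (feed (tm_state M) e c c).
Notation feed_const := (feed_const (tm_state M) e c c).
Notation call := (call e inv c c get put).
Notation finished := (finished (R := tm_state M) e c).
Notation blank := (@blank T W (tm_state M) M e).

Let blank_init w : blank (tm_start M,
  fun t => (if t == tin then word_tape W w else fun=> None, 0)).
Proof. by move=> i; exists 0. Qed.

Lemma wp_call_feed w u Q m : tm_computes M w u -> blank m ->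
  m.2 tin = (word_tape W w, 0) -> m.2 tout = (word_tape W [::], 0) ->
  (forall m', finished u m' -> m'.2 tout = (word_tape W [::], 0) -> Q m') ->
  wp (call (feed tin)) Q m.
Proof.
move=> hM hb hi ho q; apply: (wp_call eK cK putK hM hb) => m1 hl ha.
apply: (wp_feed eK cK (w := w) (i := 0) _ _ _ hl) => //; first by rewrite ha.
rewrite drop0 => m2 hl2 _ ha2; split=> // m3 hf ha3; apply: q => //.
by rewrite ha3 // ha2 // ha.
Qed.

Lemma first_bit_computable : exists N, forall w b u,
  tm_computes M w (b :: u) -> tm_computes N w [:: b].
Proof.
exists (machine (Seq (call (feed tin)) (copy_bit (tm_state M) e c tout))
  (tm_start M) tin tout) => w b u hM.
apply: wp_computes; apply: wp_seq.
apply: (wp_call_feed hM (blank_init w)) => //; first by rewrite word_tape_nil.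
move=> m [hs _] ho; apply: (wp_copy_bit eK (u := [::]) (i := 0) _ _ hs) => //.
by move=> m' _ ->.
Qed.

Lemma wp_go_copy b u Q m : finished (b :: u) m ->
  m.2 tout = (word_tape W [::], 0) ->
  (forall m', (m'.2 tout).1 = word_tape W u -> Q m') ->
  wp (Seq (go (e (tm_out M)) MoveRight) (copy_out (tm_state M) e c tout)) Q m.
Proof.
move=> [hs _] ho q; apply: wp_seq; apply: wp_go.
have hr := simulates_read hs.
apply: (wp_copy_out eK (u := [::]) (v := b :: u) (i := 1)) => //.
  rewrite set_tape_eq; apply: (simulates_move MoveRight _ hs).
  by case: (read _) hr.
by move=> m'; rewrite /= drop0; apply: q.
Qed.

(** Removing the leading [true] turns [enc_idk (Some v)] into [enc_vec v]. *)
Lemma behead_computable : exists N, forall w b u,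
  tm_computes M w (b :: u) -> tm_computes N w u.
Proof.
exists (machine (Seq (call (feed tin)) (Seq (go (e (tm_out M)) MoveRight)
  (copy_out (tm_state M) e c tout))) (tm_start M) tin tout) => w b u hM.
apply: wp_computes; apply: wp_seq.
apply: (wp_call_feed hM (blank_init w)) => //; first by rewrite word_tape_nil.
by move=> m hf ho; apply: (wp_go_copy hf ho).
Qed.

(** The counter is kept without the closing [false] of [enc_nat], so that counting up only appends a
    [true]; [attempt] supplies the [false] when feeding. *)
Definition increment : prog T W (tm_state M) :=
  Seq (sweep tcnt MoveRight isSome)
    (Seq (act_on tcnt (fun=> (Some (inl true), Stay))) (rewind tcnt)).

Lemma wp_increment n Q m : m.2 tcnt = (word_tape W (nseq n true), 0) ->
  Q (set_tape m tcnt (word_tape W (nseq n.+1 true), 0)) -> wp increment Q m.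
Proof.
move=> hm q; apply: wp_seq; apply: (@wp_sweep _ _ _ _ _ _ n);
  rewrite hm ![(_, _).1]/= ![(_, _).2]/=.
- by move=> i hi; rewrite iter_right add0r word_tapeE // size_nseq.
- by rewrite iter_right add0r -{2}(size_nseq n true) word_tape_size.
apply: wp_seq; apply: wp_act_on.
rewrite set_tape_set set_tape_eq iter_right add0r.
have -> : write (Some (inl true), Stay) (word_tape W (nseq n true), n%:Z) =
    (word_tape W (nseq n.+1 true), n%:Z).
  have -> : nseq n.+1 true = rcons (nseq n true) true.
    by rewrite -cats1 -(nseqD n 1) addn1.
  by rewrite -word_tape_rcons size_nseq.
apply: (@wp_rewind _ _ _ _ (nseq n.+1 true) n); first by rewrite size_nseq.
  by rewrite set_tape_eq.
by rewrite set_tape_set.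
Qed.

Definition attempt : prog T W (tm_state M) :=
  call (Seq (feed tcnt) (Seq (feed_const false) (feed tin))).

(** The first attempt precedes the loop so that the test has an output to inspect. Each later
    attempt needs the tapes of [M] erased first. At the end the tag bit [true] is skipped. *)
Definition search : prog T W (tm_state M) :=
  Seq attempt
    (Seq (While (fun _ s => ~~ is_bit true (dec c (s (e (tm_out M)))).1)
            (Seq (clean_all (tm_state M) e c c) (Seq increment attempt)))
      (Seq (go (e (tm_out M)) MoveRight) (copy_out (tm_state M) e c tout))).

Definition counting w n (m : memory T W (tm_state M)) : Prop :=
  [/\ m.2 tin = (word_tape W w, 0), m.2 tout = (word_tape W [::], 0) &
      m.2 tcnt = (word_tape W (nseq n true), 0)].

Lemma wp_attempt w n u Q m : tm_computes M (enc_nat n ++ w) u -> blank m ->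
  counting w n m -> (forall m', finished u m' -> counting w n m' -> Q m') ->
  wp attempt Q m.
Proof.
move=> hM hb [h1 h2 h3] q; apply: (wp_call eK cK putK hM hb) => m1 hl ha.
apply: wp_seq; apply: (wp_feed eK cK (w := nseq n true) (i := 0) _ _ _ hl) => //.
  by rewrite ha.
rewrite drop0 => m2 hl2 hc ha2; apply: wp_seq.
apply: (wp_feed_const eK cK hl2) => m3 hl3 ha3.
apply: (wp_feed eK cK (w := w) (i := 0) _ _ _ hl3) => //.
  by rewrite ha3 // ha2 // ha.
rewrite drop0 => m4 hl4 hi ha4; split=> // m5 hf ha5; apply: q => //; split.
- by rewrite ha5.
- by rewrite ha5 // ha4 // ha3 // ha2 // ha.
- by rewrite ha5 // ha4 // ha3.
Qed.

(** The runs for the parameters below [n] halt too, with answer idk, so they can be made one after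
    another without dovetailing. *)
Lemma search_computable : exists N, forall w n u,
  (forall j, (j < n)%N -> tm_computes M (enc_nat j ++ w) [:: false]) ->
  tm_computes M (enc_nat n ++ w) (true :: u) -> tm_computes N w u.
Proof.
exists (machine search (tm_start M) tin tout) => w n u hfalse htrue.
apply: wp_computes.
set Q := fun _ => _; set m := (_, _).
have hb : blank m by exact: blank_init.
have hc : counting w 0 m by split=> //; rewrite word_tape_nil.
apply: wp_seq.
have hword j : (j <= n)%N -> tm_computes M (enc_nat j ++ w)
    (if (j < n)%N then [:: false] else true :: u).
  by case: ltnP => [/hfalse//|hj hj']; rewrite (_ : j = n) //; lia.
apply: (wp_attempt (hword 0%N _) hb hc) => // m1.
move=> hf hc1; apply: wp_seq.
have [k hk] : exists k, (n - 0)%N = k by eexists.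
(* Induction on the number [n - j] of attempts left, with the initial counter [0] generalised to
   [j]. *)
elim: k {m hb hc}0%N m1 hk (leq0n n) hf hc1 => [|k ih] j m hk hj hf hc.
- have hjn : (j < n)%N = false by lia.
  rewrite hjn in hf; apply: wp_while_false.
    by rewrite (simulates_read hf.1) word_tapeE.
  by case: hc => _ ho _; apply: (wp_go_copy hf ho).
- have hjn : (j < n)%N by lia.
  rewrite hjn in hf; apply: wp_while_true.
    by rewrite (simulates_read hf.1) word_tapeE.
  apply: wp_seq; apply: (wp_clean_all eK cK hf.2) => m1 hb1 ha1.
  case: hc => h1 h2 h3.
  apply: wp_seq; apply: (@wp_increment j); first by rewrite ha1.
  apply: (wp_attempt (hword j.+1 hjn)) => //.
  + by split; rewrite ?set_tape_eq // set_tape_ne // ha1.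
  + move=> m2 hf2 hc2.
    by apply: (ih j.+1) => //; lia.
Qed.

End OneMachine.

(** * A machine that consults [M1] before running [M2] *)

Section TwoMachines.
Variables M1 M2 : turing_machine.

Let T : finType := (option bool + (tm_tape M1 + tm_tape M2))%type.
Let W : finType := (option (bool + tm_work M1) * bool +
                    option (bool + tm_work M2) * bool)%type.
Let R : finType := (tm_state M1 * tm_state M2)%type.
Let tin : T := inl None.
Let tout : T := inl (Some false).
Let e1 (i : tm_tape M1) : T := inr (inl i).
Let e2 (i : tm_tape M2) : T := inr (inr i).
Let inv1 (t : T) := if t is inr (inl i) then Some i else None.
Let inv2 (t : T) := if t is inr (inr i) then Some i else None.
Let c1 a : W := inl a.
Let c2 a : W := inr a.
Let dc1 (a : W) := if a is inl a' then a' else (None, false).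
Let dc2 (a : W) := if a is inr a' then a' else (None, false).
Let get1 (r : R) := r.1.
Let get2 (r : R) := r.2.
Let put1 (r : R) q : R := (q, r.2).
Let put2 (r : R) q : R := (r.1, q).

Let eK1 : pcancel e1 inv1. Proof. by []. Qed.
Let eK2 : pcancel e2 inv2. Proof. by []. Qed.
Let cK1 : cancel c1 dc1. Proof. by []. Qed.
Let cK2 : cancel c2 dc2. Proof. by []. Qed.
Let putK1 r q : get1 (put1 r q) = q. Proof. by []. Qed.
Let putK2 r q : get2 (put2 r q) = q. Proof. by []. Qed.

(** The tag bit of [enc_idk] is written before [M2] starts, and the output of [M2] is appended to
    it. [M1] always reads the whole input tape; stripping moves the head past the unary number only
    for [M2]. *)
Definition guarded_call (strip : bool) : prog T W R :=
  Seq (call e1 inv1 c1 dc1 get1 put1 (feed R e1 c1 dc1 tin))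
    (If (fun _ s => is_bit true (dec dc1 (s (e1 (tm_out M1)))).1)
      (Seq (act_on tout (fun=> (Some (inl true), MoveRight)))
        (Seq (if strip then strip_nat tin else skip T W R)
          (Seq (call e2 inv2 c2 dc2 get2 put2 (feed R e2 c2 dc2 tin))
            (copy_out R e2 dc2 tout))))
      (act_on tout (fun=> (Some (inl false), MoveRight)))).

(* With [strip], the input starts with a unary number that [M2] does not see. *)
Lemma guarded_call_computes (strip : bool) n w b v :
  let w1 := if strip then enc_nat n ++ w else w in
  tm_computes M1 w1 [:: b] -> (b -> tm_computes M2 w v) ->
  tm_computes (machine (guarded_call strip) (tm_start M1, tm_start M2) tin tout)
    w1 (if b then true :: v else [:: false]).
Proof.
move=> w1 h1 h2; apply: wp_computes.
set Q := fun _ => _; set m := (_, _).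
have hb1 : blank e1 m by move=> i; exists 0.
apply: wp_seq; apply: (wp_call eK1 cK1 putK1 h1 hb1) => m1 hl1 ha1.
apply: (wp_feed eK1 cK1 (w := w1) (i := 0) _ _ _ hl1) => //; first by rewrite ha1.
rewrite drop0 => m2 hl2 hi2 ha2; split=> // m3 [hs3 _] ha3.
have ho : m3.2 tout = (word_tape W [::], 0).
  by rewrite ha3 // ha2 // ha1 // word_tape_nil.
have hi : m3.2 tin = (word_tape W w1, 0) by rewrite ha3.
have hb : blank e2 m3.
  by move=> i; exists 0; rewrite ha3 // ha2 // ha1.
have hw b' : write (Some (inl b'), MoveRight) (word_tape W [::], 0) =
    (word_tape W [:: b'], 1).
  by rewrite -(word_tape_rcons W [::]).
apply: wp_if; rewrite (simulates_read hs3) word_tapeE //=.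
rewrite {}/Q; case: b h1 h2 hs3 => h1 h2 hs3; last first.
  by apply: wp_act_on; rewrite ho hw set_tape_eq.
pose Q (m' : memory T W R) := (m'.2 tout).1 = word_tape W (true :: v).
apply: wp_seq; apply: wp_act_on; rewrite ho hw; apply: wp_seq.
rewrite -/Q; set m4 := set_tape _ _ _.
pose i := if strip then n.+1 else 0%N.
(* Both values of [strip] lead to the same situation: the input head is at [i] and all other tapes
   are as in [m4]. *)
suff {hi} H : forall m5, m5.2 tin = (word_tape W w1, i%:Z) ->
    (forall t, t != tin -> m5.2 t = m4.2 t) ->
    wp (Seq (call e2 inv2 c2 dc2 get2 put2 (feed R e2 c2 dc2 tin))
            (copy_out R e2 dc2 tout)) Q m5.
  rewrite /i /w1 in H hi *; case: (strip) H hi => H hi.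
    apply: (@wp_strip_nat _ _ _ _ n w); first by rewrite set_tape_ne.
    by apply: H => [|t ht]; rewrite ?set_tape_eq // set_tape_ne.
  by apply: wp_skip; apply: H => //; rewrite set_tape_ne.
move=> m5 hi5 hm5.
have hb5 : blank e2 m5 by move=> j; have [h hj] := hb j; exists h; rewrite hm5.
have hiw : (i <= size w1)%N /\ drop i w1 = w.
  rewrite /i /w1; case: (strip); last by rewrite drop0.
  have hn : size (enc_nat n) = n.+1 by rewrite size_rcons size_nseq.
  by rewrite drop_size_cat // size_cat hn leq_addr.
apply: wp_seq; apply: (wp_call eK2 cK2 putK2 (h2 isT) hb5) => m6 hl6 ha6.
apply: (wp_feed eK2 cK2 (w := w1) (i := i) _ _ _ hl6) => //.
- exact: hiw.1.
- by rewrite ha6.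
rewrite hiw.2 => m7 hl7 hi7 ha7; split=> // m8 [hs8 _] ha8.
apply: (wp_copy_out eK2 (u := [:: true]) (i := 0) _ _ hs8) => //.
  by rewrite ha8 // ha7 // ha6 // hm5 // set_tape_eq.
by move=> m9; rewrite drop0.
Qed.

End TwoMachines.

(** * Consequences for algorithms and recursive sequences *)

Section Algorithms.
Variables (d k : nat) (Omega : Type) (Lambda : 'I_k -> Omega -> rat).
Implicit Type iota : Omega.

Lemma enc_idk_head (o : option 'rV[rat]_d) :
  exists u, enc_idk o = (o != None) :: u.
Proof. by case: o => [v|]; eexists. Qed.

Lemma algorithm_is_some (Gamma : Omega -> option 'rV[rat]_d) :
  algorithm Lambda (@enc_idk d) Gamma ->
  algorithm Lambda enc_bool (fun iota => Gamma iota != None).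
Proof.
move=> [M hM]; have [N hN] := first_bit_computable M.
exists N => iota; have [u hu] := enc_idk_head (Gamma iota).
by apply: (hN _ _ u); rewrite -hu.
Qed.

Lemma recursive_is_some (Gamma : nat -> Omega -> option 'rV[rat]_d) :
  recursive_sequence Lambda (@enc_idk d) Gamma ->
  recursive_sequence Lambda enc_bool (fun n iota => Gamma n iota != None).
Proof.
move=> [M hM]; have [N hN] := first_bit_computable M.
exists N => n iota; have [u hu] := enc_idk_head (Gamma n iota).
by apply: (hN _ _ u); rewrite -hu.
Qed.

Lemma idk_functionE (Gamma : Omega -> option 'rV[rat]_d) iota :
  idk_function Gamma iota = (Gamma iota != None).
Proof. by rewrite /idk_function; congr negb; apply/asboolP/eqP. Qed.

Section Guarded.
Variables (Xis : Omega -> bool) (Gs : Omega1 Xis -> 'rV[rat]_d).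
Hypothesis hGs : algorithm (restrict_Lambda Lambda (Xis := Xis)) (@enc_vec d) Gs.

(** A total function lets [guard] be written without membership proofs. Computability of the
    extension is not claimed: the machine for [Gs] is run only on inputs of [Omega1 Xis]. *)
Lemma exists_extension : exists G : Omega -> 'rV[rat]_d,
  forall x : Omega1 Xis, G (sval x) = Gs x.
Proof.
suff /choice : forall iota, exists v, forall h : Xis iota = true, v = Gs (exist _ iota h).
  by move=> [G hG]; exists G => -[iota h]; apply: hG.
move=> iota; case: (pselect (Xis iota = true)) => h; last by exists 0.
by exists (Gs (exist _ iota h)) => h'; rewrite (bool_irrelevance h h').
Qed.

Variables (G : Omega -> 'rV[rat]_d) (hG : forall x : Omega1 Xis, G (sval x) = Gs x).

Definition guard (B : Omega -> bool) iota : option 'rV[rat]_d :=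
  if B iota then Some (G iota) else None.

Lemma enc_guard B iota : enc_idk (guard B iota) =
  if B iota then true :: enc_vec (G iota) else [:: false].
Proof. by rewrite /guard; case: (B iota). Qed.

(** Assuming only that [B] lies below [Xis] covers both [Xis] itself and its approximations; it
    ensures that the machine for [Gs] is started only where it halts. *)
Lemma algorithm_guard (B : Omega -> bool) :
  (forall iota, B iota -> Xis iota) -> algorithm Lambda enc_bool B ->
  algorithm Lambda (@enc_idk d) (guard B).
Proof.
move=> hB [M1 h1]; have [M2 h2] := hGs.
eexists => iota; rewrite enc_guard.
apply: (@guarded_call_computes M1 M2 false 0) => [|/hB hX]; first exact: h1.
by have := h2 (exist _ iota hX); rewrite -hG.
Qed.

Lemma recursive_guard (B : nat -> Omega -> bool) :
  (forall n iota, B n iota -> Xis iota) ->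
  recursive_sequence Lambda enc_bool B ->
  recursive_sequence Lambda (@enc_idk d) (fun n => guard (B n)).
Proof.
move=> hB [M1 h1]; have [M2 h2] := hGs.
eexists => n iota; rewrite enc_guard.
apply: (@guarded_call_computes M1 M2 true n) => [|/hB hX]; first exact: h1.
by have := h2 (exist _ iota hX); rewrite -hG.
Qed.

End Guarded.
End Algorithms.

(** * Characterisation of idk functions, without and with a giving-up parameter *)

Theorem theorem3p8 (R : realType) (d k : nat) (Omega : Type)
    (Lambda : 'I_k -> Omega -> rat) (hLambda : determines_inputs Lambda)
    (dist : 'rV[R]_d -> 'rV[R]_d -> R) (hdist : is_metric dist)
    (Xi : Omega -> set 'rV[R]_d)
    (kappa : R) (hkappa : 0 <= kappa)
    (Xis : Omega -> bool) :
  ((exists Gamma : Omega -> option 'rV[rat]_d,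
      trustworthy_AI Lambda dist Xi kappa Gamma /\
      idk_function Gamma =1 Xis)
   <->
   (Delta0A Lambda Xis /\ solvable_on_Omega1 Lambda dist Xi kappa Xis))
  /\
  ((exists Gamma : nat -> Omega -> option 'rV[rat]_d,
      trustworthy_giving_up_AI Lambda dist Xi kappa Gamma /\
      giving_up_idk_function Gamma =1 Xis)
   <->
   (Sigma1A Lambda Xis /\ solvable_on_Omega1 Lambda dist Xi kappa Xis)).
Proof.
split; split.
- move=> [Gamma [[hA hT] hX]].
  have hX' iota : (Gamma iota != None) = Xis iota by rewrite -hX idk_functionE.
  split; first by eexists; [exact: algorithm_is_some hA|].
  have /choice[Gs hGs] : forall x : Omega1 Xis, exists v, Gamma (sval x) = Some v.
    move=> [iota h] /=; move: (hX' iota); rewrite h.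
    by case: (Gamma iota) => // v _; exists v.
  exists Gs => [|x]; last exact: hT.
  have [M hM] := hA; have [N hN] := behead_computable M.
  exists N => x; apply: (hN _ true).
  by have := hM (sval x); rewrite hGs.
- move=> [[B hB hBX] [Gs hGs hS]].
  have [G hG] := exists_extension Gs.
  exists (guard G B); split.
    split; first by apply: (algorithm_guard hGs hG) => // iota; rewrite hBX.
    move=> iota v; rewrite /guard hBX; case: ifP => // h [<-].
    by have := hS (exist _ iota h); rewrite -hG.
  by move=> iota; rewrite idk_functionE /guard hBX; case: (Xis iota).
- move=> [Gamma [[[hA hR hG] hT] hX]].
  have hX' iota : Xis iota <-> exists n, Gamma n iota != None.
    rewrite -hX /giving_up_idk_function; split.
      by move=> /asboolPn/existsNP[n /eqP hn]; exists n.
    by move=> [n /eqP hn]; apply/asboolPn => /(_ n).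
  (* Trustworthiness forbids withdrawing an answer, which gives the monotonicity required by
     [Sigma1A]. *)
  have hmono iota n n' : (n <= n')%N -> Gamma n iota != None -> Gamma n' iota != None.
    by move=> hn /eqP h; have [v ->] := hT iota n h n' hn.
  split.
    exists (fun n iota => Gamma n iota != None); split.
    + by move=> n; exact: (algorithm_is_some (hA n)).
    + exact: recursive_is_some.
    + move=> iota n; have := hmono iota n n.+1 (leqnSn n).
      by case: (_ != None) => // ->.
    + move=> iota; apply: cvg_near_cst.
      case: (boolP (Xis iota)) => [/hX'[n hn]|h].
        by exists n => // n' /= hn'; rewrite (hmono _ _ _ hn' hn).
      apply: nearW => n; apply: contraNF h => hn; apply/hX'; by exists n.
  (* The value chosen is the answer at the least successful parameter, which is the one that
     [search] returns. *)
  have /choice[Gs hGs] : forall x : Omega1 Xis, exists v, exists2 n,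
      Gamma n (sval x) = Some v & forall j, (j < n)%N -> Gamma j (sval x) = None.
    move=> [iota /= /hX' h]; case: (ex_minnP h) => n hn hmin.
    move: hn; case hv: (Gamma n iota) => [v|//] _; exists v, n => // j hj.
    by apply/eqP; apply: contraLR hj => /hmin; rewrite -leqNgt.
  exists Gs => [|x].
    have [M hM] := hR; have [N hN] := search_computable M.
    exists N => x; have [n hn hlt] := hGs x.
    apply: (hN _ n) => [j /hlt hj|].
      by have := hM j (sval x); rewrite hj.
    by have := hM n (sval x); rewrite hn.
  have [n hn _] := hGs x.
  have [|v] := hT (sval x) n _ n (leqnn n); first by rewrite hn.
  by rewrite hn => -[->].
- move=> [[B [hA hR hM hL]] [Gs hGs hS]].
  have [G hG] := exists_extension Gs.
  have hmono iota n n' : (n <= n')%N -> B n iota -> B n' iota.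
    move=> hn h; elim: n' hn => [|n' ih]; first by rewrite leqn0 => /eqP <-.
    rewrite leq_eqVlt => /orP[/eqP <-//|]; rewrite ltnS => /ih.
    by have := hM iota n'; case: (B n' iota) => //; case: (B _ _).
  (* Singletons are open in [bool], so the convergent sequence is eventually constant. *)
  have hlim iota : exists n0, forall n, (n0 <= n)%N -> B n iota = Xis iota.
    have : nbhs (Xis iota) [set Xis iota] by [].
    move=> /(hL iota)[n0 _ hn0]; exists n0 => n hn; exact: (hn0 n hn).
  have hBX n iota : B n iota -> Xis iota.
    move=> h; have [n0 hn0] := hlim iota.
    (* At [maxn n n0] the approximation has reached its limit and, by monotonicity, is still
       true. *)
    rewrite -(hn0 (maxn n n0)) ?leq_maxr //; apply: hmono h; exact: leq_maxl.
  exists (fun n => guard G (B n)); split; first split.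
  + split.
    * by move=> n; apply: (algorithm_guard hGs hG) => // iota; apply: hBX.
    * by apply: (recursive_guard hGs hG).
    * move=> iota; case: (pselect (exists n, B n iota)) => [h|h]; last first.
        by left=> n; rewrite /guard; case: ifP => // hn; case: h; exists n.
      (* The switch from idk to an answer happens at the first [n0] where the approximation is
         true. *)
      right; case: (ex_minnP h) => n0 h0 hmin; exists n0; split=> n hn.
        rewrite /guard; case: ifP => // /hmin; lia.
      by rewrite /guard (hmono _ _ _ hn h0).
  + move=> iota n; rewrite /guard; case: ifP => // h _ n' hn'.
    rewrite (hmono _ _ _ hn' h); exists (G iota) => //.
    by have := hS (exist _ iota (hBX _ _ h)); rewrite -hG.
  + move=> iota; rewrite /giving_up_idk_function.
    have [n0 hn0] := hlim iota.
    case: (boolP (Xis iota)) => h.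
      apply/asboolPn => /(_ n0); by rewrite /guard hn0 // h.
    apply/negbTE; rewrite negbK; apply/asboolP => n; rewrite /guard.
    by case: ifP => // /hBX; rewrite (negbTE h).
Qed.
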